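(* Let $\mathbf{k}$ be a field of characteristic $0$ and let $(A,\mu,\alpha)$ be a multiplicative right Hom-alternative algebra over $\mathbf{k}$. Suppose that $\alpha$ is injective and that $A$ has no left zero-divisors. Then $A$ is a Hom-alternative algebra.
   Context: A Hom-algebra over $\mathbf{k}$ is a triple $(A,\mu,\alpha)$ where $A$ is a $\mathbf{k}$-module, $\mu\colon A^{\otimes 2}\to A$ is a bilinear map (written $xy=\mu(x,y)$; not assumed associative, commutative or unital), and $\alpha\colon A\to A$ is a linear map (the twisting map). It is multiplicative if $\alpha(xy)=\alpha(x)\alpha(y)$ for all $x,y\in A$. The Hom-associator is $(x,y,z)=(xy)\alpha(z)-\alpha(x)(yz)$. $A$ is right Hom-alternative if $(x,y,y)=0$ for all $x,y\in A$, left Hom-alternative if $(x,x,y)=0$ for all $x,y\in A$, and Hom-alternative if it is both left and right Hom-alternative. A left zero-divisor is a non-zero element $a\in A$ for which there exists a non-zero $b\in A$ with $ab=0$. *)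

(* Defs.v *)
From mathcomp Require Import all_boot all_algebra.

Set Implicit Arguments.
Unset Strict Implicit.
Unset Printing Implicit Defensive.

Import GRing.Theory.
Local Open Scope ring_scope.

(* A Hom-algebra over k is given by an lmodType A over k, a bilinear map mu and
   a linear map alpha; mu need not be associative, commutative or unital. *)
Section HomAlgebra.
Variables (k : fieldType) (A : lmodType k).
Variables (mu : {bilinear A -> A -> A}) (alpha : {linear A -> A}).

Definition multiplicative : Prop :=
  forall x y : A, alpha (mu x y) = mu (alpha x) (alpha y).

Definition hom_associator (x y z : A) : A :=
  mu (mu x y) (alpha z) - mu (alpha x) (mu y z).

Definition right_hom_alternative : Prop :=
  forall x y : A, hom_associator x y y = 0.

Definition left_hom_alternative : Prop :=
  forall x y : A, hom_associator x x y = 0.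

Definition hom_alternative : Prop :=
  left_hom_alternative /\ right_hom_alternative.

Definition left_zero_divisor (a : A) : Prop :=
  a <> 0 /\ exists b : A, b <> 0 /\ mu a b = 0.

End HomAlgebra.

(* Main.v *)
(* Adjoining inverses of the injective twisting map alpha to A and untwisting the
   product to [x . y = alpha^-1 (x y)] gives an ordinary right alternative algebra
   without zero divisors; so it suffices to treat alpha = id.

   In a right alternative algebra let D be the operator [a |-> (a, x, y)], let S be
   [a |-> (a x) y - a (y x)], c = [x, y], r = (c, x, y), p = (x, x, y); operators
   act on the right and R_u is right multiplication by u.  The Moufang identity
   yields D S = 0, R_r = S D and D R_p = R_p S.  Hence r r = c D S D = 0, so that
   r = 0 and S D = 0 as soon as there are no zero divisors.  This in turn gives
   D R_p D = 0, and some linearizations of r = 0 lead to p (p c) = 0.  So p and c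
   cannot both be nonzero; where p is nonzero, x commutes with all elements, which
   forces p = 0. *)

From HB Require Import structures.
Require Import Defs.
From mathcomp Require Import all_boot all_algebra.

Set Implicit Arguments.
Unset Strict Implicit.
Unset Printing Implicit Defensive.

(* [Defs] comes last because [GRing.Theory] has its own [multiplicative]. *)
Import GRing.Theory Defs.
Local Open Scope ring_scope.

(** * Identities in the free nonassociative ring *)

Inductive monomial := Atom of nat | Prod of monomial & monomial.

Definition monomial_comparable : comparable monomial.
Proof. by rewrite /comparable /decidable; decide equality; apply: eq_comparable. Defined.

HB.instance Definition _ :=
  hasDecEq.Build monomial (compareP monomial_comparable).

Inductive expression :=
  | Var of nat
  | Zero
  | Add of expression & expression
  | Opp of expression
  | Mul of expression & expression.

(* The monomials occurring positively, and those occurring negatively. *)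
Fixpoint normal_form (e : expression) : seq monomial * seq monomial :=
  match e with
  | Var i => ([:: Atom i], [::])
  | Zero => ([::], [::])
  | Add e1 e2 =>
      let n1 := normal_form e1 in let n2 := normal_form e2 in
      (n1.1 ++ n2.1, n1.2 ++ n2.2)
  | Opp e1 => let n1 := normal_form e1 in (n1.2, n1.1)
  | Mul e1 e2 =>
      let n1 := normal_form e1 in let n2 := normal_form e2 in
      ([seq Prod s t | s <- n1.1, t <- n2.1] ++ [seq Prod s t | s <- n1.2, t <- n2.2],
       [seq Prod s t | s <- n1.1, t <- n2.2] ++ [seq Prod s t | s <- n1.2, t <- n2.1])
  end.

Section Reflection.
Variables (V : zmodType) (mul : V -> V -> V).
Hypothesis mulDl : forall x y z, mul (x + y) z = mul x z + mul y z.
Hypothesis mulDr : forall x y z, mul x (y + z) = mul x y + mul x z.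

Fixpoint eval_monomial (env : seq V) (t : monomial) : V :=
  match t with
  | Atom i => env`_i
  | Prod t1 t2 => mul (eval_monomial env t1) (eval_monomial env t2)
  end.

Fixpoint eval (env : seq V) (e : expression) : V :=
  match e with
  | Var i => env`_i
  | Zero => 0
  | Add e1 e2 => eval env e1 + eval env e2
  | Opp e1 => - eval env e1
  | Mul e1 e2 => mul (eval env e1) (eval env e2)
  end.

Lemma mul0l x : mul 0 x = 0.
Proof. by apply: (addrI (mul 0 x)); rewrite -mulDl !addr0. Qed.

Lemma mul0r x : mul x 0 = 0.
Proof. by apply: (addrI (mul x 0)); rewrite -mulDr !addr0. Qed.

Lemma mulNl x y : mul (- x) y = - mul x y.
Proof. by apply/eqP; rewrite -addr_eq0 -mulDl addNr mul0l. Qed.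

Lemma mulNr x y : mul x (- y) = - mul x y.
Proof. by apply/eqP; rewrite -addr_eq0 -mulDr addNr mul0r. Qed.

Lemma mul_sum_eval env (s t : seq monomial) :
  mul (\sum_(u <- s) eval_monomial env u) (\sum_(u <- t) eval_monomial env u) =
  \sum_(u <- [seq Prod u v | u <- s, v <- t]) eval_monomial env u.
Proof.
rewrite big_allpairs_dep; elim: s => [|u s IHs]; first by rewrite !big_nil mul0l.
rewrite !big_cons mulDl IHs; congr (_ + _).
by elim: t {IHs} => [|v t IHt]; rewrite ?big_nil ?mul0r // !big_cons mulDr IHt.
Qed.

Lemma eval_normal_form env e :
  eval env e = \sum_(t <- (normal_form e).1) eval_monomial env t
             - \sum_(t <- (normal_form e).2) eval_monomial env t.
Proof.
elim: e => /= [i||e1 -> e2 ->|e1 ->|e1 -> e2 ->].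
- by rewrite big_seq1 big_nil subr0.
- by rewrite big_nil subr0.
- by rewrite !big_cat opprD addrACA.
- by rewrite opprB.
- rewrite !big_cat /= -!mul_sum_eval mulDl !mulDr mulNl !mulNr mulNl opprK opprD.
  by rewrite [X in _ + X]addrC addrACA.
Qed.

(** Negative monomials are moved to the other side, so a comparison of multisets suffices and no
    terms have to be cancelled. *)
Lemma eval_eq env e1 e2 :
  perm_eq ((normal_form e1).1 ++ (normal_form e2).2)
          ((normal_form e2).1 ++ (normal_form e1).2) ->
  eval env e1 = eval env e2.
Proof.
move=> e12; rewrite !eval_normal_form; apply/eqP.
rewrite subr_eq addrAC eq_sym subr_eq -!big_cat /=.
by rewrite (perm_big _ e12).
Qed.

(** Used for linear combination certificates: each equation accounts for its own difference of sides
    in that of the goal, [esym] gives the coefficient -1, and the remainder must hold in the free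
    nonassociative ring. *)
Lemma add_hypothesis (l r u v : V) : u = v -> l + v = r + u -> l = r.
Proof. by move=> ->; apply: addIr. Qed.

End Reflection.

Ltac atom_index x env :=
  lazymatch env with
  | x :: _ => constr:(O)
  | _ :: ?env' => let i := atom_index x env' in constr:(S i)
  end.

Ltac atoms mul e env :=
  lazymatch e with
  | 0 => env
  | ?a + ?b => let env' := atoms mul a env in atoms mul b env'
  | - ?a => atoms mul a env
  | mul ?a ?b => let env' := atoms mul a env in atoms mul b env'
  | _ => match constr:(tt) with
         | _ => let _ := atom_index e env in env
         | _ => constr:(e :: env)
         end
  end.

Ltac reify mul e env :=
  lazymatch e with
  | 0 => constr:(Zero)
  | ?a + ?b =>
      let a' := reify mul a env in let b' := reify mul b env in constr:(Add a' b')
  | - ?a => let a' := reify mul a env in constr:(Opp a')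
  | mul ?a ?b =>
      let a' := reify mul a env in let b' := reify mul b env in constr:(Mul a' b')
  | _ => let i := atom_index e env in constr:(Var i)
  end.

Ltac nonassoc_ring mul mulDl mulDr :=
  lazymatch goal with
  | |- @eq ?T ?l ?r =>
      let env0 := atoms mul l (@nil T) in
      let env := atoms mul r env0 in
      let el := reify mul l env in
      let er := reify mul r env in
      apply: (@eval_eq _ mul mulDl mulDr env el er); vm_compute; reflexivity
  end.

(* [h] is a nested pair of equations; the difference of the two sides of each is
   subtracted from the goal. *)
Ltac add_hypotheses h :=
  lazymatch h with
  | (?h1, ?h2) => add_hypotheses h1; add_hypotheses h2
  | _ => apply: (add_hypothesis h)
  end.

(** * Right alternative rings without zero divisors *)

Section RightAlternative.
Variables (V : zmodType) (mul : V -> V -> V).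
Hypothesis mulDl : forall x y z, mul (x + y) z = mul x z + mul y z.
Hypothesis mulDr : forall x y z, mul x (y + z) = mul x y + mul x z.
Hypothesis two_torsion_free : forall x : V, x + x = 0 -> x = 0.

Local Infix "*" := mul : ring_scope.

Definition associator x y z := (x * y) * z - x * (y * z).
Definition commutator x y := x * y - y * x.
Definition dual_associator a x y := (a * x) * y - a * (y * x).

Local Ltac nonassoc :=
  repeat match goal with v := _ |- _ => subst v end;
  rewrite /associator /commutator /dual_associator;
  nonassoc_ring mul mulDl mulDr.
Local Ltac lincomb h := add_hypotheses h; nonassoc.

Lemma double_inj (u v : V) : u + u = v + v -> u = v.
Proof.
move=> e; apply/subr0_eq/two_torsion_free.
by rewrite addrACA -opprD e subrr.
Qed.

Hypothesis associator_diag : forall x y, associator x y y = 0.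

Lemma associator_alt a x y : associator a x y + associator a y x = 0.
Proof.
by lincomb (associator_diag a (x + y), esym (associator_diag a x),
            esym (associator_diag a y)).
Qed.

(** * The Moufang identity and its consequences for D and S *)

Lemma mulr_eq a (u v : V) : u = v -> a * u = a * v.
Proof. by move=> ->. Qed.

Lemma mull_eq a (u v : V) : u = v -> u * a = v * a.
Proof. by move=> ->. Qed.

(** The map [u |-> R_u] respects the Jordan product [u o v = u v + v u], and
    [2 (x y) x = x o (x o y) - (x x) o y]; hence the doubling. *)
Lemma right_moufang a x y : ((a * x) * y) * x = a * ((x * y) * x).
Proof.
apply: double_inj.
by lincomb (associator_alt a x (x * y + y * x), associator_alt (a * x) x y,
            mull_eq x (associator_alt a x y),
            esym (mull_eq y (associator_diag a x)),
            esym (associator_diag (a * y) x),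
            esym (associator_alt a (x * x) y),
            mulr_eq a (associator_diag y x),
            esym (mulr_eq a (associator_alt x x y))).
Qed.

Lemma right_moufang_linear a x y z :
  ((a * x) * y) * z + ((a * z) * y) * x =
  a * ((x * y) * z) + a * ((z * y) * x).
Proof.
by lincomb (right_moufang a (x + z) y, esym (right_moufang a x y),
            esym (right_moufang a z y)).
Qed.

(** Swapping the last two arguments gives [- (a, x y, x)], to which Moufang applies. *)
Lemma associator_mul a x y : associator a x (x * y) = associator a x y * x.
Proof.
by lincomb (associator_alt a x (x * y), esym (right_moufang a x y)).
Qed.

Lemma associator_mul_linear a x y z :
  associator a x y * z + associator a z y * x =
  associator a x (z * y) + associator a z (x * y).
Proof.
by lincomb (esym (associator_mul a (x + z) y), associator_mul a x y,
            associator_mul a z y).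
Qed.

(** This is [D S = 0]. The linearized [associator_mul] is taken with [z := y x] and, after
    exchanging x and y, with [z := x y]. In the sum the right sides cancel by Moufang, and the left
    sides give [-2 a D S]. *)
Lemma dual_associator_associator a x y :
  dual_associator (associator a x y) x y = 0.
Proof.
apply: two_torsion_free.
have e : associator a (y * x) y = associator a x y * y.
  by lincomb (associator_alt a (y * x) y, esym (associator_mul a y x),
              esym (mull_eq y (associator_alt a y x))).
by lincomb (esym (associator_mul_linear a x y (y * x)),
            esym (associator_mul_linear a y x (x * y)),
            mull_eq x e, right_moufang (a * x) y x,
            esym (mulr_eq a (right_moufang x y x)),
            esym (associator_alt a (y * x) (x * y)),
            esym (associator_alt a ((x * y) * x) y),
            associator_alt (associator a x y) x y,
            mull_eq (x * y) (associator_alt a x y)).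
Qed.

Lemma associator_mul_commutator a x y :
  associator a x y * commutator x y = - associator (associator a x y) x y.
Proof. by lincomb (dual_associator_associator a x y). Qed.

(** This is [R_r = S D]. The linearized Moufang identity with [z := c] is antisymmetrized in x and
    y; then [S = D + R_c] and [D D = - D R_c] are used. *)
Lemma mul_associator_commutator a x y :
  a * associator (commutator x y) x y = associator (dual_associator a x y) x y.
Proof.
apply: double_inj.
set c := commutator x y.
by lincomb (mulr_eq a (associator_alt c x y), esym (associator_alt (a * c) x y),
            mull_eq c (associator_alt a x y), right_moufang_linear a x y c,
            esym (right_moufang_linear a y x c),
            esym (dual_associator_associator a x y),
            esym (dual_associator_associator a x y)).
Qed.

(** This is [D R_p = R_p S]. Since [(a, x, x) = 0], the Teichmüller identity gives [a p = (a x, x,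
    y) - (a, x x, y) + (a, x, x y)]. S is evaluated on these terms by [D S = 0] and its
    linearizations. *)
Lemma associator_mul_alternator a x y :
  associator a x y * associator x x y =
  dual_associator (a * associator x x y) x y.
Proof.
set b := associator a x y.
have polar_l z : dual_associator b z y +
                 dual_associator (associator a z y) x y = 0.
  by lincomb (dual_associator_associator a (x + z) y,
              esym (dual_associator_associator a x y),
              esym (dual_associator_associator a z y)).
have polar_r z : dual_associator b x z +
                 dual_associator (associator a x z) x y = 0.
  by lincomb (dual_associator_associator a x (y + z),
              esym (dual_associator_associator a x y),
              esym (dual_associator_associator a x z)).
have e : dual_associator (associator a x x * y) x y = 0.
  rewrite associator_diag; nonassoc.
by lincomb (esym (associator_alt b (x * x) y), polar_l (x * x),
            associator_alt b x (x * y), esym (polar_r (x * y)),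
            mull_eq x (associator_alt b x y),
            esym (mull_eq x (dual_associator_associator a x y)),
            esym (associator_diag (b * y) x),
            esym (dual_associator_associator (a * x) x y), e).
Qed.

(** The Teichmüller identity for [a, x, y, x], in which Moufang cancels [(a, x, y) x] against
    [(a, x y, x)]. *)
Lemma mul_alternator a x y :
  a * associator x x y = associator (a * x) x y - associator a x (y * x).
Proof.
by lincomb (mulr_eq a (associator_alt x x y), esym (associator_alt (a * x) x y),
            right_moufang a x y).
Qed.

(** * Consequences of the absence of zero divisors *)

Hypothesis no_zero_divisor : forall x y, x * y = 0 -> x = 0 \/ y = 0.

Lemma associator_commutator x y : associator (commutator x y) x y = 0.
Proof.
set r := associator _ x y.
suff [] : r = 0 \/ r = 0 by [].
apply: no_zero_divisor; rewrite mul_associator_commutator.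
by rewrite dual_associator_associator; nonassoc.
Qed.

Lemma associator_dual_associator a x y :
  associator (dual_associator a x y) x y = 0.
Proof.
by rewrite -mul_associator_commutator associator_commutator; nonassoc.
Qed.

Lemma alternator_or_commutator_eq0 x y :
  associator x x y = 0 \/ commutator x y = 0.
Proof.
set p := associator x x y; set c := commutator x y.
have [->|/eqP p_neq0] := eqVneq p 0; first by left.
have cancel_p u : u * p = 0 -> u = 0 by case/no_zero_divisor.
(* The identity [r = 0] is linearized in the direction [y x] because [[x, y x] = p + c x] involves
   p. *)
pose f := commutator x (y * x).
have fE : associator f x (y * x) = 0 by apply: associator_commutator.
have fD_cE : associator f x y + associator c x (y * x) = 0.
  by lincomb (associator_commutator x (y + y * x),
              esym (associator_commutator x y),
              esym (associator_commutator x (y * x))).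
have fD : associator f x y = 0.
  (* Here [(f D) p = (f p) S], and [f p = (f x) D] by [fE], which S kills. *)
  apply: cancel_p; rewrite associator_mul_alternator mul_alternator fE subr0.
  exact: dual_associator_associator.
have cE : associator c x (y * x) = 0 by rewrite -fD_cE fD add0r.
have cp : c * p = associator (c * x) x y by rewrite mul_alternator cE subr0.
have f_eq : f = p + c * x by lincomb (esym (associator_alt x x y)).
have pcD : p * c = - associator p x y by apply: associator_mul_commutator.
(* As [f D = 0], [- p D] equals [(c x) D]; by [cp], p and c commute. *)
have pc : p * c = associator (c * x) x y.
  have e : associator (p + c * x) x y = 0 by rewrite -f_eq.
  by lincomb (pcD, esym e).
(* Since [p = x D], [p p = (x p) S], and [S D = 0]. *)
have ppD : associator (p * p) x y = 0.
  by rewrite associator_mul_alternator associator_dual_associator.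
(* From [S = D + R_c] and [ppD], [(p c) p = - (p D) p = - (p p) S = - (p p) c]. Then
   [associator_alt p p c] leaves [p (p c) + p (c p) = 0]. *)
have ppc : p * (p * c) = 0.
  apply: two_torsion_free.
  have pcp : p * (c * p) = p * (p * c) by rewrite cp pc.
  have e : associator p x y * p = dual_associator (p * p) x y.
    exact: associator_mul_alternator.
  by lincomb (mull_eq p pcD, esym e, esym ppD, esym (associator_alt p p c),
              esym pcp).
by right; case: (no_zero_divisor ppc) => // /no_zero_divisor [].
Qed.

Theorem right_alternative_left_alternative x y : associator x x y = 0.
Proof.
have [//|/eqP p_neq0] := eqVneq (associator x x y) 0.
(* Both [(x, x, z)] and [[x, z]] are additive in z, and a group is not the union of two proper
   subgroups. *)
have comm z : commutator x z = 0.
  have [pz|//] := alternator_or_commutator_eq0 x z.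
  have cy : commutator x y = 0.
    by case: (alternator_or_commutator_eq0 x y).
  have [pyz|cyz] := alternator_or_commutator_eq0 x (y + z).
    by case: p_neq0; lincomb (pyz, esym pz).
  by lincomb (cyz, esym cy).
(* Here [p = - (x, y, x) = x (y x) - (x y) x], and both terms equal [(y x) x]. *)
by lincomb (comm (y * x), esym (mull_eq x (comm y)), associator_alt x x y).
Qed.

End RightAlternative.

(** * Inverting the twisting map *)

Local Open Scope quotient_scope.

Section Localization.
Variables (A : zmodType) (alpha : {additive A -> A}).
Hypothesis alpha_inj : injective alpha.

Lemma iter_additive n : {morph iter n alpha : x y / x + y}.
Proof. by elim: n => [//|n IHn] x y; rewrite !iterS IHn raddfD. Qed.

Lemma iter_opp n : {morph iter n alpha : x / - x}.
Proof. by elim: n => [//|n IHn] x; rewrite !iterS IHn raddfN. Qed.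

Lemma iter_inj n : injective (iter n alpha).
Proof. by elim: n => [//|n IHn] x y /alpha_inj /IHn. Qed.

(* The pair [(n, a)] stands for [alpha^-n a]. *)
Definition twisted_eq (u v : nat * A) :=
  iter v.1 alpha u.2 == iter u.1 alpha v.2.

Lemma twisted_eq_equiv : equiv_class_of twisted_eq.
Proof.
split=> [u|u v|v u w]; rewrite /twisted_eq //= 1?eq_sym // => /eqP uv /eqP vw.
(* Transitivity holds after raising by the exponent of the middle pair, which injectivity
   removes. *)
apply/eqP; apply: (@iter_inj v.1).
by rewrite -!iterD addnC iterD -uv -iterD addnC iterD vw -!iterD addnC.
Qed.

Canonical twisted_eq_rel := EquivRelPack twisted_eq_equiv.

(** The direct limit of [A -> A -> ...] with every map equal to [alpha]. *)
Definition localization := {eq_quot twisted_eq_rel}.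
HB.instance Definition _ := Choice.on localization.

Definition frac n a : localization := \pi_localization (n, a).

Lemma frac_eq n m a b :
  frac n a = frac m b <-> iter m alpha a = iter n alpha b.
Proof. by split=> [/eqmodP/eqP|e] //; apply/eqmodP/eqP. Qed.

Lemma frac_inj n : injective (frac n).
Proof. by move=> a b /frac_eq /iter_inj. Qed.

Lemma frac_raise m n a : frac n a = frac (n + m)%N (iter m alpha a).
Proof. by apply/frac_eq; rewrite -iterD. Qed.

Lemma frac_surj (x : localization) : exists n a, x = frac n a.
Proof. by elim/quotW: x => -[n a]; exists n, a. Qed.

Lemma frac_common2 (x y : localization) :
  exists n a b, x = frac n a /\ y = frac n b.
Proof.
have [[n [a ->]] [m [b ->]]] := (frac_surj x, frac_surj y).
exists (n + m)%N, (iter m alpha a), (iter n alpha b).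
by split; [apply: frac_raise | rewrite addnC; apply: frac_raise].
Qed.

Lemma frac_common3 (x y z : localization) :
  exists n a b c, [/\ x = frac n a, y = frac n b & z = frac n c].
Proof.
have [[n [a [b [-> ->]]]] [m [c ->]]] := (frac_common2 x y, frac_surj z).
exists (n + m)%N, (iter m alpha a), (iter m alpha b), (iter n alpha c).
by split; [apply: frac_raise.. | rewrite addnC; apply: frac_raise].
Qed.

Lemma frac_repr (x : localization) : frac (repr x).1 (repr x).2 = x.
Proof. by rewrite /frac -surjective_pairing reprK. Qed.

Definition frac_add (x y : localization) :=
  frac ((repr x).1 + (repr y).1)%N
       (iter (repr y).1 alpha (repr x).2 + iter (repr x).1 alpha (repr y).2).

(** Independence of the representatives chosen by [repr]; over a common exponent the group laws then
    reduce to those of [A]. *)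
Lemma frac_addE n a b : frac_add (frac n a) (frac n b) = frac n (a + b).
Proof.
have /frac_eq ea := frac_repr (frac n a); have /frac_eq eb := frac_repr (frac n b).
apply/frac_eq; rewrite !iter_additive -!iterD; congr (_ + _).
- by rewrite addnC [in RHS]addnC !iterD ea.
- by rewrite addnC !iterD eb.
Qed.

Definition frac_opp (x : localization) := frac (repr x).1 (- (repr x).2).

Lemma frac_oppE n a : frac_opp (frac n a) = frac n (- a).
Proof.
have /frac_eq ea := frac_repr (frac n a).
by apply/frac_eq; rewrite !iter_opp ea.
Qed.

Lemma frac0 n : frac n 0 = frac 0 0.
Proof.
by apply/frac_eq => /=; elim: n => //= n <-; rewrite raddf0.
Qed.

Lemma frac_addA : associative frac_add.
Proof.
move=> x y z; have [n [a [b [c [-> -> ->]]]]] := frac_common3 x y z.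
by rewrite !frac_addE addrA.
Qed.

Lemma frac_addC : commutative frac_add.
Proof.
move=> x y; have [n [a [b [-> ->]]]] := frac_common2 x y.
by rewrite !frac_addE addrC.
Qed.

Lemma frac_add0 : left_id (frac 0 0) frac_add.
Proof.
by move=> x; have [n [a ->]] := frac_surj x; rewrite -(frac0 n) frac_addE add0r.
Qed.

Lemma frac_addN : left_inverse (frac 0 0) frac_opp frac_add.
Proof.
move=> x; have [n [a ->]] := frac_surj x.
by rewrite frac_oppE frac_addE addNr frac0.
Qed.

HB.instance Definition _ :=
  GRing.isZmodule.Build localization frac_addA frac_addC frac_add0 frac_addN.

Lemma fracD n a b : frac n (a + b) = frac n a + frac n b.
Proof. by rewrite -frac_addE. Qed.

Lemma frac_eq0 n a : frac n a = 0 <-> a = 0.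
Proof. by rewrite -[0 in X in X <-> _](frac0 n); split=> [/frac_inj|->]. Qed.

(** * The untwisted product on the localization *)

Variable mu : A -> A -> A.
Hypothesis muDl : forall x y z, mu (x + y) z = mu x z + mu y z.
Hypothesis muDr : forall x y z, mu x (y + z) = mu x y + mu x z.
Hypothesis alpha_mu : forall x y, alpha (mu x y) = mu (alpha x) (alpha y).

(* The localized product followed by [alpha^-1], whence the successor. *)
Definition frac_mul (x y : localization) : localization :=
  frac ((repr x).1 + (repr y).1).+1%N
       (mu (iter (repr y).1 alpha (repr x).2) (iter (repr x).1 alpha (repr y).2)).

Lemma iter_mu n x y :
  iter n alpha (mu x y) = mu (iter n alpha x) (iter n alpha y).
Proof. by elim: n => //= n ->. Qed.

Lemma frac_mulE n a b : frac_mul (frac n a) (frac n b) = frac n.+1 (mu a b).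
Proof.
have /frac_eq ea := frac_repr (frac n a); have /frac_eq eb := frac_repr (frac n b).
apply/frac_eq; rewrite !iter_mu -!iterD; congr (mu _ _).
- by rewrite addSnnS addnC iterD ea -iterD addSn addnC.
- by rewrite addSnnS addnC iterD eb -iterD addSn.
Qed.

Lemma frac_mulDl x y z : frac_mul (x + y) z = frac_mul x z + frac_mul y z.
Proof.
have [n [a [b [c [-> -> ->]]]]] := frac_common3 x y z.
by rewrite -fracD !frac_mulE muDl fracD.
Qed.

Lemma frac_mulDr x y z : frac_mul x (y + z) = frac_mul x y + frac_mul x z.
Proof.
have [n [a [b [c [-> -> ->]]]]] := frac_common3 x y z.
by rewrite -fracD !frac_mulE muDr fracD.
Qed.

Lemma frac_mul_eq0 x y :
  (forall a b, mu a b = 0 -> a = 0 \/ b = 0) ->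
  frac_mul x y = 0 -> x = 0 \/ y = 0.
Proof.
move=> mu_eq0; have [n [a [b [-> ->]]]] := frac_common2 x y.
by rewrite frac_mulE => /frac_eq0/mu_eq0[]->; [left | right]; rewrite frac0.
Qed.

(** A product of two elements of exponent [n] has exponent [n.+1], so the remaining factor must be
    raised by [alpha] before multiplying; this produces the Hom-associator. *)
Lemma frac_associator n a b c :
  associator frac_mul (frac n a) (frac n b) (frac n c) =
  frac n.+2 (mu (mu a b) (alpha c) - mu (alpha a) (mu b c)).
Proof.
have raise u : frac n u = frac n.+1 (alpha u).
  by rewrite (frac_raise 1) addn1.
apply: (addIr (frac_mul (frac n a) (frac_mul (frac n b) (frac n c)))).
rewrite /associator addrNK !frac_mulE.
by rewrite [frac n c]raise [frac n a]raise !frac_mulE -fracD addrNK.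
Qed.

End Localization.

Local Close Scope quotient_scope.

(** * Transfer back to the Hom-algebra *)

Theorem corollary1p6 (k : fieldType) (hchar : [pchar k] =i pred0)
    (A : lmodType k) (mu : {bilinear A -> A -> A}) (alpha : {linear A -> A})
    (hmult : multiplicative mu alpha)
    (hright : right_hom_alternative mu alpha)
    (hinj : injective alpha)
    (hnzd : ~ exists a : A, left_zero_divisor mu a) :
  hom_alternative mu alpha.
Proof.
have muDl x y z : mu (x + y) z = mu x z + mu y z by apply: linearDl.
have muDr x y z : mu x (y + z) = mu x y + mu x z by apply: linearDr.
have mu_eq0 a b : mu a b = 0 -> a = 0 \/ b = 0.
  move=> ab0; have [->|/eqP a_neq0] := eqVneq a 0; first by left.
  have [->|/eqP b_neq0] := eqVneq b 0; first by right.
  by case: hnzd; exists a; split=> //; exists b.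
have two_neq0 : 2%:R != 0 :> k.
  by have := hchar 2; rewrite !inE /= => ->.
have double_eq0 (x : localization hinj) : x + x = 0 -> x = 0.
  have [n [a ->]] := frac_surj x; rewrite -fracD => /frac_eq0 aa0.
  apply/frac_eq0/eqP; have : 2%:R *: a == 0 by rewrite scaler_nat mulr2n aa0.
  by rewrite scaler_eq0 (negPf two_neq0).
(* Elements of [A] enter with exponent 0, so their associator has exponent 2. *)
split=> // x y; apply/(frac_eq0 hinj 2).
rewrite -(frac_associator hinj hmult).
apply: right_alternative_left_alternative => //.
- exact: frac_mulDl.
- exact: frac_mulDr.
- move=> X Y; have [n [a [b [-> ->]]]] := frac_common2 X Y.
  by rewrite frac_associator //; apply/frac_eq0/hright.
- by move=> X Y; apply: frac_mul_eq0.
Qed.
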